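(* Fix an integer $n>1$ and let $p$ be a prime. Let $$c_7(n) = \max_{0\le d\le n-1} \frac{d(n-1-d)}{n-1+d},$$ where the maximum is over all integers $d$ with $0\le d\le n-1$. Then the series $\zeta^R_{\mathbb{Z}^n,\,p}(s)$ diverges for all $s\in\mathbb{C}$ such that $\operatorname{Re}(s)\le c_7(n)$.
   Context: A subring of $\mathbb{Z}^n$ is a sublattice (additive subgroup) of $\mathbb{Z}^n$ that contains the multiplicative identity $(1,1,\ldots,1)$ and is closed under componentwise multiplication. For a positive integer $m$, $f_n(m)$ denotes the number of subrings of $\mathbb{Z}^n$ of finite index $m$. For a prime $p$, the local factor at $p$ of the subring zeta function of $\mathbb{Z}^n$ is the series $\zeta^R_{\mathbb{Z}^n,\,p}(s) = \sum_{e=0}^\infty f_n(p^e)p^{-es}$. *)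

(* Defs.v *)
From mathcomp Require Import all_boot all_order all_algebra.
From mathcomp Require Import finmap.
From mathcomp Require Import all_classical all_reals all_analysis.
From mathcomp Require Import complex.

Set Implicit Arguments.
Unset Strict Implicit.
Unset Printing Implicit Defensive.

Import Order.TTheory GRing.Theory Num.Theory.
Import numFieldNormedType.Exports.

Local Open Scope classical_set_scope.
Local Open Scope ring_scope.
Local Open Scope complex_scope.
Local Open Scope card_scope.

(* The ring structure on finite functions is componentwise, with unit [ffun => 1]. *)
Notation Zn n := {ffun 'I_n -> int}.

(* A set is coerced to the boolean predicate it classically defines. *)
Definition is_subring (n : nat) (L : set (Zn n)) : Prop :=
  subring_closed (mem L).

Definition cosets (n : nat) (L : set (Zn n)) : set (set (Zn n)) :=
  [set [set v + x | x in L] | v in [set: Zn n]].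

Definition subrings_of_index (n m : nat) : set (set (Zn n)) :=
  [set L | is_subring L /\ cosets L #= `I_m].

(* [fset_set] is the empty finite set on infinite sets, but only finitely many
   subgroups of Z^n have a given finite index. *)
Definition num_subrings (n m : nat) : nat :=
  #|` fset_set (@subrings_of_index n m)|.

Definition cexp (R : realType) (z : R[i]) : R[i] :=
  (expR (complex.Re z))%:C * (cos (complex.Im z) +i* sin (complex.Im z)).

Definition nat_cpow (R : realType) (k : nat) (z : R[i]) : R[i] :=
  cexp ((ln k%:R : R)%:C * z).

(* The alias R[i]^o carries the topology of the complex modulus. *)
Definition local_zeta_term (R : realType) (n p : nat) (s : R[i]) (e : nat) :
    R[i]^o :=
  (num_subrings n (p ^ e))%:R * nat_cpow p (- (e%:R * s)).

(* d ranges over 0, ..., n-1.  The base value 0 of the iterated maximum is the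
   term d = 0, so it does not change the maximum. *)
Definition c7 (R : realType) (n : nat) : R :=
  \big[Num.max/0]_(d < n) ((d * (n - 1 - d))%:R / (n - 1 + d)%:R).

(* Main.v *)
(** Write n - 1 = a + d and q = p^k.  For a matrix A with entries in [0, q), the
vectors v of Z^n such that x_i = v_i - v_0 (i in the first block) is divisible
by q and v_j - v_0 - sum_i A_ij x_i (j in the second block) is divisible by q^2
form a subring: all differences v_i - v_0 are divisible by q, so the quadratic
terms in a product are divisible by q^2.  It has index q^(a + 2d), and
distinct matrices give distinct subrings, so there are at least q^(ad) subrings
of that index.  When Re s <= ad / (a + 2d), the corresponding terms of the
series have modulus at least 1 for every k, so they do not tend to 0. *)
Require Import Defs.
From mathcomp Require Import all_boot all_order all_algebra.
From mathcomp Require Import all_classical all_reals all_analysis.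
From mathcomp Require Import complex ring.
Import Order.TTheory GRing.Theory Num.Theory.
Import numFieldNormedType.Exports.
Local Open Scope classical_set_scope.
Local Open Scope ring_scope.
Local Open Scope complex_scope.

(** * Cosets of a subring and its index *)

Lemma card_eq_finType (F : finType) : ([set: F] #= `I_#|F|)%card.
Proof.
have rK : range (@enum_rank F) = [set: 'I_#|F|].
  by apply/seteqP; split=> // i _; exists (enum_val i); rewrite ?enum_valK.
have rank_inj : {in [set: F] &, injective (@enum_rank F)}.
  by move=> x y _ _; apply: enum_rank_inj.
have := inj_card_eq rank_inj; rewrite rK card_eq_sym => h.
by apply: card_eq_trans h _; rewrite card_eq_sym card_II.
Qed.

Lemma cosets_eqP {n : nat} {L : set (Zn n)} (v w : Zn n) : is_subring L ->
  ([set v + x | x in L] = [set w + x | x in L]) <-> L (v - w).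
Proof.
case=> L1 LB _; have L0 : L 0 by have := LB _ _ L1 L1; rewrite subrr inE.
have {}LB x y : L x -> L y -> L (x - y).
  by move=> Lx Ly; have := LB x y; rewrite !inE; apply.
have LN x : L x -> L (- x) by move=> Lx; rewrite -sub0r; apply: LB.
have LD x y : L x -> L y -> L (x + y).
  by move=> Lx Ly; rewrite -[y]opprK; apply: LB => //; apply: LN.
split=> [vw|Lvw].
  have : [set w + x | x in L] v by rewrite -vw; exists 0; rewrite ?addr0.
  by case=> x Lx <-; rewrite addrC addKr.
apply/seteqP; split=> _ [x Lx <-].
  by exists ((v - w) + x); [apply: LD | rewrite addrA subrKC].
exists (x - (v - w)); first exact: LB.
by rewrite opprB addrCA subrKC addrC.
Qed.

(** The map [phi] separates exactly the cosets of [L] and [psi] picks a representative for each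
    value, so [f |-> psi f + L] is a bijection from [F] onto the cosets. *)
Lemma card_cosets_finType {n : nat} {L : set (Zn n)} {F : finType}
    (phi : Zn n -> F) (psi : F -> Zn n) : is_subring L -> cancel psi phi ->
  (forall v w, phi v = phi w <-> L (v - w)) -> (cosets L #= `I_#|F|)%card.
Proof.
move=> Lring psiK phiE.
pose h f := [set psi f + x | x in L].
have -> : cosets L = range h.
  apply/seteqP; split=> [_ [v _ <-]|_ [f _ <-]]; last by exists (psi f).
  by exists (phi v) => //; apply/(cosets_eqP _ _ Lring)/phiE; rewrite psiK.
apply: card_eq_trans (card_eq_finType F); apply: inj_card_eq.
by move=> f g _ _ /(cosets_eqP _ _ Lring)/phiE; rewrite !psiK.
Qed.

(** Pigeonhole: two of the [m + 1] cosets of [0, v, ..., m v] coincide, so [L] contains [(j - i) v]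
    with [0 < j - i <= m], and [j - i] divides [m!]. *)
Lemma fact_mul_index {n m : nat} {L : set (Zn n)} (v : Zn n) :
  is_subring L -> (cosets L #= `I_m)%card -> L (v *+ m`!).
Proof.
move=> Lring Lm; case: (Lring) => L1 LB _.
have L0 : 0 \in L by have := LB _ _ L1 L1; rewrite subrr.
have LMn x j : x \in L -> x *+ j \in L.
  move=> Lx; elim: j => // j IHj; rewrite mulrS -[x *+ j]opprK.
  by apply: (LB) => //; rewrite -sub0r; apply: (LB).
pose f j := [set v *+ j + x | x in L].
have [f_inj|] := pselect {in `I_m.+1 &, injective f}.
  have fs : f @` `I_m.+1 `<=` cosets L by move=> _ [j _ <-]; exists (v *+ j).
  have := inj_card_eq f_inj; rewrite card_eq_sym => /card_eqPle[+ _].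
  move=> /card_le_trans/(_ (subset_card_le fs)).
  by move: Lm => /card_eqPle[+ _] => /[swap] /card_le_trans/[apply];
    rewrite card_le_II ltnn.
move=> nf_inj.
have [i [j [ij jm fij]]] : exists i j, [/\ (i < j)%N, (j <= m)%N & f j = f i].
  apply: contrapT => H; apply: nf_inj => i j; rewrite !inE /= !ltnS => im jm fij.
  apply: contrapT => /eqP; rewrite neq_ltn => /orP[] ij; apply: H.
    by exists i, j.
  by exists j, i.
have /(cosets_eqP _ _ Lring) := fij.
rewrite -mulrnBr ?(ltnW ij)// => /mem_set Lv.
have /dvdnP[c ->] : (j - i %| m`!)%N.
  by apply: dvdn_fact; rewrite subn_gt0 ij/= (leq_trans (leq_subr _ _)).
by rewrite mulnC mulrnA; apply/set_mem/LMn.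
Qed.

(** * Residues, and finiteness of the set of subrings of given index *)

Lemma modz_lt {q : nat} (q_gt0 : (0 < q)%N) (x : int) : (`|(x %% q)%Z| < q)%N.
Proof.
by rewrite -ltz_nat gez0_abs ?modz_ge0 ?lt0n_neq0// ltz_pmod// ltz_nat.
Qed.

Definition ord_modz {q : nat} (q_gt0 : (0 < q)%N) (x : int) : 'I_q :=
  Ordinal (modz_lt q_gt0 x).

Lemma ord_modzE {q : nat} (q_gt0 : (0 < q)%N) (x : int) :
  (ord_modz q_gt0 x)%:Z = (x %% q)%Z.
Proof. by rewrite /= gez0_abs ?modz_ge0 ?lt0n_neq0. Qed.

Lemma ord_modzP {q : nat} (q_gt0 : (0 < q)%N) (x y : int) :
  ord_modz q_gt0 x = ord_modz q_gt0 y <-> (q %| x - y)%Z.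
Proof.
rewrite -eqz_mod_dvd; split=> [xy|/eqP xy]; first by rewrite -!ord_modzE xy.
by apply/val_inj/eqP; rewrite -eqz_nat !ord_modzE xy.
Qed.

Lemma ord_modzK {q : nat} (q_gt0 : (0 < q)%N) (i : 'I_q) :
  ord_modz q_gt0 i%:Z = i.
Proof. by apply/val_inj; rewrite /= modz_nat/= modn_small. Qed.

(** A subring of index [m] contains [m! Z^n], so it is determined by the residue vectors modulo [m!]
    that it contains; these form a subset of a finite set. *)
Lemma finite_subrings_of_index (n m : nat) :
  finite_set (@subrings_of_index n m).
Proof.
pose K := m`!.
pose lift (g : {ffun 'I_n -> 'I_K}) : Zn n := [ffun i => (g i)%:Z].
pose code (L : set (Zn n)) := [set g : {ffun 'I_n -> 'I_K} | lift g \in L]%SET.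
have code_sub L L' : @subrings_of_index n m L -> @subrings_of_index n m L' ->
    code L = code L' -> L `<=` L'.
  move=> [Lring Lm] [L'ring L'm] LL' v Lv.
  pose g : {ffun 'I_n -> 'I_K} := [ffun i => ord_modz (fact_gt0 m) (v i)].
  pose w : Zn n := [ffun i => (v i %/ K)%Z].
  have vE : v = lift g + w *+ K.
    apply/ffunP => i; rewrite ffunE ffunMnE !ffunE ord_modzE addrC.
    by rewrite {1}(divz_eq (v i) K) mulrC -mulr_natl natz.
  have Lg : lift g \in L.
    case: (Lring) => _ LB _; rewrite -[lift g](addrK (w *+ K)) -vE.
    by apply: LB; rewrite inE//; apply: fact_mul_index.
  have : g \in code L by rewrite inE.
  rewrite LL' inE => L'g; have L'w := fact_mul_index w L'ring L'm.
  case: (L'ring) => L'1 LB _; rewrite vE -[w *+ K]opprK; apply/set_mem/LB => //.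
  rewrite -sub0r; apply: (LB); last exact/mem_set.
  by have := LB _ _ L'1 L'1; rewrite subrr.
have code_inj : {in @subrings_of_index n m &, injective code}.
  by move=> L L' /set_mem SL /set_mem SL' LL'; apply/seteqP; split; apply: code_sub.
by rewrite -(eq_finite_set (inj_card_eq code_inj)); apply: finite_finset.
Qed.

(** * The subrings attached to matrices *)

Section MatrixSubring.
Variables a d q : nat.
Hypothesis q_gt0 : (0 < q)%N.
Local Notation mats := {ffun 'I_a * 'I_d -> 'I_q}.
Local Notation Zad := (Zn (a + d).+1).
Implicit Types (A B : mats) (v w : Zad).

(** These differences vanish on the identity, so congruences imposed on them hold for it
    automatically. *)
Definition dev v (i : 'I_(a + d)) : int := v (lift ord0 i) - v ord0.
Definition free_coord v (i : 'I_a) : int := dev v (lshift d i).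
Definition bound_coord A v (j : 'I_d) : int :=
  dev v (rshift a j) - \sum_(i < a) (A (i, j))%:Z * free_coord v i.

Definition matrix_subring A : set Zad :=
  [set v | (forall i, (q %| free_coord v i)%Z) /\
           (forall j, ((q * q)%N %| bound_coord A v j)%Z)].

Lemma free_coordB v w i :
  free_coord (v - w) i = free_coord v i - free_coord w i.
Proof. by rewrite /free_coord /dev !ffunE; ring. Qed.

Lemma bound_coordB A v w j :
  bound_coord A (v - w) j = bound_coord A v j - bound_coord A w j.
Proof.
rewrite /bound_coord (eq_bigr (fun i => (A (i, j))%:Z * free_coord v i
    - (A (i, j))%:Z * free_coord w i)); last first.
  by move=> i _; rewrite free_coordB mulrBr.
by rewrite sumrB /dev !ffunE; ring.
Qed.

Lemma dvd_bound_dev A v j : matrix_subring A v -> (q %| dev v (rshift a j))%Z.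
Proof.
case=> qf qb; rewrite -(subrK (\sum_(i < a) (A (i, j))%:Z * free_coord v i)
  (dev v _)) rpredD//.
  by apply: dvdz_trans (qb j); rewrite PoszM dvdz_mulr.
by apply: rpred_sum => i _; rewrite dvdz_mull.
Qed.

(** Expanding [(v_0 + x)(w_0 + y) - v_0 w_0] isolates the quadratic term [x y] from the part linear
    in the differences. *)
Lemma devM v w i :
  dev (v * w) i = dev v i * dev w i + (v ord0 * dev w i + w ord0 * dev v i).
Proof. by rewrite /dev !ffunE; ring. Qed.

Lemma matrix_subring_subring A : is_subring (matrix_subring A).
Proof.
have dev1 i : dev 1 i = 0 by rewrite /dev !ffunE subrr.
split.
- rewrite inE; split=> [i|j]; first by rewrite /free_coord dev1.
  by rewrite /bound_coord dev1 big1 ?subrr// => i _;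
    rewrite /free_coord dev1 mulr0.
- move=> v w; rewrite !inE => -[vf vb] [wf wb]; split=> [i|j].
    by rewrite free_coordB rpredB.
  by rewrite bound_coordB rpredB.
- move=> v w; rewrite !inE => Av Aw; have [vf vb] := Av; have [wf wb] := Aw.
  split=> [i|j].
    rewrite /free_coord devM rpredD ?dvdz_mull//; first exact: wf.
    by rewrite rpredD// dvdz_mull//; [exact: wf|exact: vf].
  (* The linear parts recombine into the bound coordinates of [v] and [w], divisible by [q^2]; every
     remaining term contains a product of two multiples of [q]. *)
  have -> : bound_coord A (v * w) j =
      (dev v (rshift a j) * dev w (rshift a j)
        - \sum_(i < a) (A (i, j))%:Z * (free_coord v i * free_coord w i))
      + (v ord0 * bound_coord A w j + w ord0 * bound_coord A v j).
    rewrite /bound_coord (eq_bigr (fun i =>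
      (A (i, j))%:Z * (free_coord v i * free_coord w i)
      + (v ord0 * ((A (i, j))%:Z * free_coord w i)
      + w ord0 * ((A (i, j))%:Z * free_coord v i)))); last first.
      by move=> i _; rewrite /free_coord devM; ring.
    by rewrite !big_split -!mulr_sumr devM/=; ring.
  rewrite rpredD//; last by rewrite rpredD// dvdz_mull.
  rewrite rpredB//; first by rewrite PoszM dvdz_mul// (dvd_bound_dev A).
  by apply: rpred_sum => i _; rewrite dvdz_mull// PoszM dvdz_mul.
Qed.

(** The vector with zeroth entry 0 whose free and bound coordinates are [x] and [y]; the added sum
    cancels the one subtracted in [bound_coord]. *)
Definition vec_of_coords A (x : 'I_a -> int) (y : 'I_d -> int) : Zad :=
  [ffun k => if unlift ord0 k is Some i then
     match fintype.split i with
     | inl i => x i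
     | inr j => y j + \sum_(i < a) (A (i, j))%:Z * x i
     end else 0].

Lemma free_coord_vec A x y i : free_coord (vec_of_coords A x y) i = x i.
Proof.
rewrite /free_coord /dev !ffunE liftK unlift_none subr0.
by rewrite -[lshift d i]/(unsplit (inl i)) unsplitK.
Qed.

Lemma bound_coord_vec A x y j : bound_coord A (vec_of_coords A x y) j = y j.
Proof.
rewrite /bound_coord (eq_bigr (fun i => (A (i, j))%:Z * x i)); last first.
  by move=> i _; rewrite free_coord_vec.
rewrite /dev !ffunE liftK unlift_none subr0.
by rewrite -[rshift a j]/(unsplit (inr j)) unsplitK addrK.
Qed.

(** A coset is given by [a] free coordinates modulo [q] and [d] bound coordinates modulo [q^2], all
    of which can be prescribed independently. *)
Lemma card_cosets_matrix_subring A :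
  (cosets (matrix_subring A) #= `I_(q ^ (a + 2 * d)))%card.
Proof.
have qq_gt0 : (0 < q * q)%N by rewrite muln_gt0 q_gt0.
pose F : finType := ({ffun 'I_a -> 'I_q} * {ffun 'I_d -> 'I_(q * q)})%type.
have <- : #|F| = (q ^ (a + 2 * d))%N.
  by rewrite card_prod !card_ffun !card_ord expnD expnM -mulnn.
pose phi v : F := ([ffun i => ord_modz q_gt0 (free_coord v i)],
                   [ffun j => ord_modz qq_gt0 (bound_coord A v j)]).
pose psi (f : F) := vec_of_coords A (fun i => (f.1 i)%:Z) (fun j => (f.2 j)%:Z).
apply: (card_cosets_finType phi psi); first exact: matrix_subring_subring.
  move=> [x y]; congr pair; apply/ffunP => i; rewrite ffunE.
    by rewrite free_coord_vec ord_modzK.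
  by rewrite bound_coord_vec ord_modzK.
move=> v w; split.
  case=> /ffunP vwf /ffunP vwb; split=> [i|j].
    by have := vwf i; rewrite !ffunE free_coordB => /ord_modzP.
  by have := vwb j; rewrite !ffunE bound_coordB => /ord_modzP.
case=> vwf vwb; congr pair; apply/ffunP => i; rewrite !ffunE; apply/ord_modzP.
  by rewrite -free_coordB.
by rewrite -bound_coordB.
Qed.

(** The vector [v] with [i]-th free coordinate [q] and all other coordinates relative to [A] zero
    lies in the subring of [A]. If it lies in that of [B], then [q^2] divides [(A_ij - B_ij) q], and
    entries in [[0, q)] congruent modulo [q] are equal. *)
Lemma matrix_subring_inj : injective matrix_subring.
Proof.
move=> A B AB; apply/ffunP => -[i j].
pose v := vec_of_coords A (fun i' => if i' == i then q%:Z else 0) (fun=> 0).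
have [_ /(_ j)] : matrix_subring B v.
  rewrite -AB; split=> [i'|j']; last by rewrite bound_coord_vec dvdz0.
  by rewrite free_coord_vec; case: eqP; rewrite ?dvdzz ?dvdz0.
have sumE (C : mats) : \sum_(i' < a) (C (i', j))%:Z * free_coord v i' =
    (C (i, j))%:Z * q%:Z.
  rewrite (bigD1 i)//= big1 ?addr0 ?free_coord_vec ?eqxx// => k /negPf ki.
  by rewrite free_coord_vec ki mulr0.
have -> : bound_coord B v j =
    bound_coord A v j + ((A (i, j))%:Z - (B (i, j))%:Z) * q%:Z.
  by rewrite /bound_coord !sumE; ring.
rewrite bound_coord_vec add0r PoszM dvdz_mul2r; last by rewrite eqz_nat -lt0n.
by move=> /(ord_modzP q_gt0); rewrite !ord_modzK.
Qed.

Lemma num_subrings_ge :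
  (q ^ (a * d) <= num_subrings (a + d).+1 (q ^ (a + 2 * d)))%N.
Proof.
(* Finiteness ensures that [fset_set] does not take its default empty value, so an injection into
   the set bounds the count from below. *)
apply: leq_card_fset_set; first exact: finite_subrings_of_index.
have -> : (q ^ (a * d))%N = #|mats| by rewrite card_ffun card_prod !card_ord.
have /card_eqPle[_ le1] := card_eq_finType mats.
apply: card_le_trans le1 _.
have inj : {in [set: mats] &, injective matrix_subring}.
  by move=> A B _ _; apply: matrix_subring_inj.
have /card_eqPle[_ le2] := inj_card_eq inj.
apply: card_le_trans le2 (subset_card_le _) => _ [A _ <-].
split; [exact: matrix_subring_subring|exact: card_cosets_matrix_subring].
Qed.

End MatrixSubring.

(** * The modulus of the terms of the series *)

Lemma norm_cexp (R : realType) (z : R[i]) :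
  `|cexp z| = (expR (complex.Re z))%:C.
Proof.
by rewrite normrM !normc_def/= cos2Dsin2 sqrtr1 expr0n addr0 sqrtr_sqr
  ger0_norm ?expR_ge0// mulr1.
Qed.

Lemma norm_local_zeta_term (R : realType) (n p : nat) (s : R[i]) (e : nat) :
  `|local_zeta_term n p s e| = ((num_subrings n (p ^ e))%:R *
     expR (- (e%:R * (ln p%:R * complex.Re s))))%:C.
Proof.
rewrite /local_zeta_term normrM normr_nat norm_cexp rmorphM/= rmorph_nat.
congr (_ * (expR _)%:C); case: s => x y.
rewrite -(rmorph_nat (real_complex R)) /=; ring.
Qed.

Lemma norm_local_zeta_term_ge1 (R : realType) (a d p k : nat) (s : R[i]) :
  (0 < p)%N -> (0 < a + d)%N ->
  complex.Re s <= (a * d)%:R / (a + 2 * d)%:R ->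
  1 <= `|local_zeta_term (a + d).+1 p s (k * (a + 2 * d))|.
Proof.
move=> p_gt0 ad_gt0 s_le; rewrite norm_local_zeta_term lecR.
have e_gt0 : 0 < (a + 2 * d)%:R :> R.
  by rewrite ltr0n (leq_trans ad_gt0)// leq_add2l leq_pmull.
have lnp_ge0 : 0 <= ln p%:R :> R by rewrite ln_ge0// ler1n.
have pE : expR (k%:R * (a * d)%:R * ln p%:R) = ((p ^ k) ^ (a * d))%:R :> R.
  by rewrite -natrM expRM_natl lnK ?posrE ?ltr0n// -expnM natrX.
have pk_gt0 : (0 < p ^ k)%N by rewrite expn_gt0 p_gt0.
(* Write 1 as [p^(kad) p^(-kad)]: the first factor is at most the number of subrings, the second at
   most the modulus of [p^(-es)] for [e = k(a + 2d)]. *)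
rewrite expnM; apply: (@le_trans _ _
  (expR (k%:R * (a * d)%:R * ln p%:R) * expR (- (k%:R * (a * d)%:R * ln p%:R)))).
  by rewrite expRN divff// gt_eqF// expR_gt0.
apply: ler_pM; rewrite ?expR_ge0//.
  by rewrite pE ler_nat num_subrings_ge.
rewrite ler_expR lerN2 natrM -!mulrA ler_wpM2l//.
rewrite mulrCA [leRHS]mulrC ler_wpM2l// mulrC -ler_pdivlMr//.
Qed.

(** * Choice of [d] and divergence *)

Lemma c7_attained (R : realType) (n : nat) (x : R) : (0 < n)%N -> x <= c7 R n ->
  exists2 d : nat, (d < n)%N & x <= (d * (n - 1 - d))%:R / (n - 1 + d)%:R.
Proof.
move=> n_gt0 x_le; apply: contrapT => H.
have lt d : (d < n)%N -> (d * (n - 1 - d))%:R / (n - 1 + d)%:R < x.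
  by move=> dn; rewrite ltNge; apply/negP => xd; apply: H; exists d.
suff : c7 R n < x by rewrite ltNge x_le.
apply/bigmax_ltP; split=> [|d _]; last exact: lt.
(* The base value 0 of the maximum must also lie below [x]; the term [d = 0] gives this. *)
by have := lt 0%N n_gt0; rewrite mul0n mul0r.
Qed.
Theorem theorem1p10 (R : realType) (n p : nat) (s : R[i]) :
  (1 < n)%N -> prime p -> complex.Re s <= c7 R n ->
  ~ cvgn (series (local_zeta_term n p s)).
Proof.
move=> n_gt1 /prime_gt0 p_gt0 s_le /cvg_series_cvg_0.
(* Convergence would make all terms from some index [N] on have modulus less than 1. *)
move=> /cvgrPdist_lt/(_ 1 ltr01)[N _ small].
have [d dn sd] := c7_attained _ _ _ (ltnW n_gt1) s_le.
pose a := (n - 1 - d)%N.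
have adE : (a + d)%N = (n - 1)%N.
  by rewrite subnK// -ltnS -subSn ?subn1// (ltnW n_gt1).
have nE : n = (a + d).+1 by rewrite adE subn1 prednK// ltnW.
have ad_gt0 : (0 < a + d)%N by rewrite adE subn_gt0.
(* Taking [k = N] gives an index at least [N], since [a + 2d > 0]. *)
have := small (N * (a + 2 * d))%N.
rewrite /= leq_pmulr; last by rewrite (leq_trans ad_gt0)// leq_add2l leq_pmull.
move=> /(_ isT); rewrite sub0r normrN; apply/negP; rewrite -real_leNgt//.
rewrite {1}nE; apply: norm_local_zeta_term_ge1 => //.
(* With [a = n - 1 - d], the denominator [n - 1 + d] is [a + 2d]. *)
by rewrite mulnC mul2n -addnn addnA adE.
Qed.
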